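(* Let $n>2$ and $\Delta\equiv1$. Then the solutions $(\rho,\bar\mu)$ of the system $X=Y=Z=0$ are given by $$\rho(b^2)=-\ln(C+Db^2),\qquad\bar\mu=4CDa^2$$ when $\mu=0$, and by $$\rho(b^2)=-\ln\big(C+D\sqrt{a^2-\mu b^2}\big),\qquad\bar\mu=(C^2-D^2a^2)\mu$$ when $\mu\neq0$, where $C$ and $D$ are constants. Here $$\begin{aligned}X=\frac{1}{b^2\Delta}\Big\{&a^2\Delta(n-2\Delta)+b^2[\mu\Delta-(a^2-\mu b^2)\Delta'](1+2b^2\rho')-(n-2)(a^2-\mu b^2)\Delta(1+2b^2\rho')^2\\&-2(a^2-\mu b^2)b^2\Delta(1+2b^2\rho')'-(n-1)\bar\mu b^2\Delta e^{2\rho}\Big\},\end{aligned}$$ $$\begin{aligned}Y=-\frac{1}{b^4\Delta}\Big\{&a^2\Delta(1-\Delta)[n+(n-2)\Delta]+(2a^2-3\mu b^2)b^2\Delta\Delta'-(a^2-\mu b^2)b^4\Delta'^2+2(a^2-\mu b^2)b^4\Delta\Delta''\\&+\mu b^2\Delta(1-\Delta)(1+2b^2\rho')-(a^2-\mu b^2)b^2[1-(n-1)\Delta]\Delta'(1+2b^2\rho')\\&-(n-2)(a^2-\mu b^2)\Delta(1-\Delta)(1+2b^2\rho')^2-2(a^2-\mu b^2)b^2\Delta(1-\Delta)(1+2b^2\rho')'\\&-(n-1)\bar\mu b^2\Delta(1-\Delta)e^{2\rho}\Big\},\end{aligned}$$ $$\begin{aligned}Z=-\frac{1}{(a^2-\mu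 b^2)b^4\Delta^2}\Big\{&a^2\Delta^2(n-2\Delta)+(2a^2-3\mu b^2)b^2\Delta\Delta'-(a^2-\mu b^2)b^4\Delta'^2+2(a^2-\mu b^2)b^4\Delta\Delta''\\&-(n-2)\mu b^2\Delta^2(1+2b^2\rho')-(n-2)(a^2-\mu b^2)\Delta^2(1+2b^2\rho')^2\\&+2(n-2)(a^2-\mu b^2)b^2\Delta^2(1+2b^2\rho')'\Big\}.\end{aligned}$$
   Context: Here $n$ is an integer, $a\neq0$ and $\mu$ are given real constants, and $b^2$ is treated as an independent real variable ranging over an open interval in $(0,\infty)$ on which $a^2-\mu b^2>0$; $\Delta=\Delta(b^2)>0$ and $\rho=\rho(b^2)$ are smooth real functions on this interval, $\bar\mu$ is a real constant, and a prime denotes $d/d(b^2)$. Equations are required to hold identically on the interval. The constants $C,D$ are such that the arguments of the logarithms are positive. *)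

(* Defs.v *)
From Stdlib Require Import Reals ZArith.
From Coquelicot Require Import Coquelicot.
Open Scope R_scope.

(* The independent variable [t : R] stands for b^2 throughout, and the prime
   d/d(b^2) is Coquelicot's [Derive]. *)

Definition in_open_itv (l r : Rbar) (t : R) : Prop :=
  Rbar_lt l t /\ Rbar_lt t r.

Definition smooth_on (I : R -> Prop) (f : R -> R) : Prop :=
  forall (k : nat) (t : R), I t -> ex_derive_n f k t.

(* 1 + 2 b^2 rho' *)
Definition U (rho : R -> R) (t : R) : R := 1 + 2 * t * Derive rho t.

Definition sysX (n : Z) (a mu mubar : R) (Delta rho : R -> R) (t : R) : R :=
  let N := IZR n in
  let d := Delta t in
  let d1 := Derive Delta t in
  let E := a ^ 2 - mu * t in
  let u := U rho t in
  let u1 := Derive (U rho) t in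
  1 / (t * d) *
  ( a ^ 2 * d * (N - 2 * d)
    + t * (mu * d - E * d1) * u
    - (N - 2) * E * d * u ^ 2
    - 2 * E * t * d * u1
    - (N - 1) * mubar * t * d * exp (2 * rho t) ).

Definition sysY (n : Z) (a mu mubar : R) (Delta rho : R -> R) (t : R) : R :=
  let N := IZR n in
  let d := Delta t in
  let d1 := Derive Delta t in
  let d2 := Derive_n Delta 2 t in
  let E := a ^ 2 - mu * t in
  let u := U rho t in
  let u1 := Derive (U rho) t in
  - (1 / (t ^ 2 * d)) *
  ( a ^ 2 * d * (1 - d) * (N + (N - 2) * d)
    + (2 * a ^ 2 - 3 * mu * t) * t * d * d1
    - E * t ^ 2 * d1 ^ 2
    + 2 * E * t ^ 2 * d * d2
    + mu * t * d * (1 - d) * u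
    - E * t * (1 - (N - 1) * d) * d1 * u
    - (N - 2) * E * d * (1 - d) * u ^ 2
    - 2 * E * t * d * (1 - d) * u1
    - (N - 1) * mubar * t * d * (1 - d) * exp (2 * rho t) ).

Definition sysZ (n : Z) (a mu : R) (Delta rho : R -> R) (t : R) : R :=
  let N := IZR n in
  let d := Delta t in
  let d1 := Derive Delta t in
  let d2 := Derive_n Delta 2 t in
  let E := a ^ 2 - mu * t in
  let u := U rho t in
  let u1 := Derive (U rho) t in
  - (1 / (E * t ^ 2 * d ^ 2)) *
  ( a ^ 2 * d ^ 2 * (N - 2 * d)
    + (2 * a ^ 2 - 3 * mu * t) * t * d * d1
    - E * t ^ 2 * d1 ^ 2
    + 2 * E * t ^ 2 * d * d2
    - (N - 2) * mu * t * d ^ 2 * u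
    - (N - 2) * E * d ^ 2 * u ^ 2
    + 2 * (N - 2) * E * t * d ^ 2 * u1 ).

Definition is_solution (I : R -> Prop) (n : Z) (a mu : R) (Delta : R -> R)
    (rho : R -> R) (mubar : R) : Prop :=
  smooth_on I rho /\
  forall t : R, I t ->
    sysX n a mu mubar Delta rho t = 0 /\
    sysY n a mu mubar Delta rho t = 0 /\
    sysZ n a mu Delta rho t = 0.

(* Main.v *)
Require Import Defs.
From Stdlib Require Import Reals ZArith Lra.
From Coquelicot Require Import Coquelicot.
Open Scope R_scope.

(** Put [f = exp (- rho)] and [E = a^2 - mu t]. For [Delta = 1] the equation
    [Y = 0] is void, [Z = 0] becomes the linear equation [2 E f'' = mu f'], and
    modulo [Z = 0] the equation [X = 0] says that
    [mubar = mu f^2 + 4 E f f' - 4 E t f'^2]. If [mu = 0] the linear equation is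
    [f'' = 0]; if [mu <> 0] it says that [f' sqrt E] is constant, and then [f] is
    affine in [sqrt E]. *)

(** * Open intervals with extended real endpoints *)

Lemma in_open_itv_locally (l r : Rbar) (t : R) :
  in_open_itv l r t -> locally t (in_open_itv l r).
Proof.
  intros [Hl Hr].
  exact (filter_and _ _ (open_Rbar_gt' _ _ Hl) (open_Rbar_lt' _ _ Hr)).
Qed.

Lemma in_open_itv_inhabited (l r : Rbar) :
  Rbar_lt l r -> exists t : R, in_open_itv l r t.
Proof.
  destruct l as [l | |], r as [r | |]; simpl; intros H; try easy;
    unfold in_open_itv.
  - exists ((l + r) / 2). simpl. lra.
  - exists (l + 1). simpl. lra.
  - exists (r - 1). simpl. lra.
  - exists 0. simpl. easy.
Qed.

Lemma in_open_itv_pos (l r : Rbar) (t : R) :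
  Rbar_le 0 l -> in_open_itv l r t -> 0 < t.
Proof. intros Hl [H _]. exact (Rbar_le_lt_trans 0 l t Hl H). Qed.

Lemma in_open_itv_convex (l r : Rbar) (x y z : R) :
  in_open_itv l r x -> in_open_itv l r y -> x <= z <= y -> in_open_itv l r z.
Proof.
  intros [Hx _] [_ Hy] [Hxz Hzy]. split.
  - exact (Rbar_lt_le_trans l x z Hx Hxz).
  - exact (Rbar_le_lt_trans z y r Hzy Hy).
Qed.

(** The segment between two points of the interval stays inside it, so constancy on segments
    applies. This is the only integration principle in the proof: each differential equation is
    solved by exhibiting a quantity with zero derivative. *)
Lemma is_derive_0_const_on (l r : Rbar) (f : R -> R) (x y : R) :
  (forall t, in_open_itv l r t -> is_derive f t 0) ->
  in_open_itv l r x -> in_open_itv l r y -> f x = f y.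
Proof.
  intros Hf.
  assert (Hlt : forall u v, in_open_itv l r u -> in_open_itv l r v -> u < v ->
    f u = f v).
  { intros u v Hu Hv Huv. apply eq_is_derive; [| exact Huv].
    intros t Ht. apply Hf. exact (in_open_itv_convex l r u v t Hu Hv Ht). }
  intros Hx Hy. destruct (Rtotal_order x y) as [H | [-> | H]]; auto.
  symmetry; auto.
Qed.

(** * Smoothness by explicit chains of derivatives *)

(** Each derivative is a witness prescribed on [I] alone, so the rules of calculus pass to order [k]
    by plain induction, with no formula for [Derive_n] of a product or a composite. *)
Fixpoint derivable_upto (I : R -> Prop) (k : nat) (f : R -> R) : Prop :=
  match k with
  | O => True
  | S k => exists f', (forall t, I t -> is_derive f t (f' t)) /\
                      derivable_upto I k f'
  end.

(** The product and chain rules keep undifferentiated factors in the derivative; this lowers their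
    order to that of the induction hypothesis. *)
Lemma derivable_upto_pred (I : R -> Prop) (k : nat) : forall f,
  derivable_upto I (S k) f -> derivable_upto I k f.
Proof.
  induction k as [| k IH]; intros f [f' [Hf Hf']]; simpl; [easy |].
  exists f'. split; [exact Hf |]. now apply IH.
Qed.

Lemma derivable_upto_const (I : R -> Prop) (k : nat) : forall c,
  derivable_upto I k (fun _ => c).
Proof.
  induction k as [| k IH]; intros c; [easy |].
  exists (fun _ => 0). split; [| apply IH].
  intros t _. auto_derive; auto.
Qed.

Lemma derivable_upto_id (I : R -> Prop) (k : nat) :
  derivable_upto I k (fun t => t).
Proof.
  destruct k as [| k]; [easy |].
  exists (fun _ => 1). split; [| apply derivable_upto_const].
  intros t _. auto_derive; auto.
Qed.

Lemma derivable_upto_opp (I : R -> Prop) (k : nat) : forall f,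
  derivable_upto I k f -> derivable_upto I k (fun t => - f t).
Proof.
  induction k as [| k IH]; intros f; [easy |].
  intros [f' [Hf Hf']].
  exists (fun t => - f' t). split; [| now apply IH].
  intros t Ht. exact (is_derive_opp f t _ (Hf t Ht)).
Qed.

Lemma derivable_upto_plus (I : R -> Prop) (k : nat) : forall f g,
  derivable_upto I k f -> derivable_upto I k g ->
  derivable_upto I k (fun t => f t + g t).
Proof.
  induction k as [| k IH]; intros f g; [easy |].
  intros [f' [Hf Hf']] [g' [Hg Hg']].
  exists (fun t => f' t + g' t). split; [| now apply IH].
  intros t Ht. exact (is_derive_plus f g t _ _ (Hf t Ht) (Hg t Ht)).
Qed.

Lemma derivable_upto_mult (I : R -> Prop) (k : nat) : forall f g,
  derivable_upto I k f -> derivable_upto I k g ->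
  derivable_upto I k (fun t => f t * g t).
Proof.
  induction k as [| k IH]; intros f g Hf Hg; [easy |].
  pose proof (derivable_upto_pred _ _ _ Hf).
  pose proof (derivable_upto_pred _ _ _ Hg).
  destruct Hf as [f' [Hf Hf']], Hg as [g' [Hg Hg']].
  exists (fun t => f' t * g t + f t * g' t).
  split; [| apply derivable_upto_plus; now apply IH].
  intros t Ht.
  exact (is_derive_mult f g t _ _ (Hf t Ht) (Hg t Ht) Rmult_comm).
Qed.

Lemma derivable_upto_comp (I J : R -> Prop) (k : nat) : forall f g,
  (forall t, I t -> J (f t)) ->
  derivable_upto J k g -> derivable_upto I k f ->
  derivable_upto I k (fun t => g (f t)).
Proof.
  induction k as [| k IH]; intros f g HIJ Hg Hf; [easy |].
  pose proof (derivable_upto_pred _ _ _ Hf).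
  destruct Hf as [f' [Hf Hf']], Hg as [g' [Hg Hg']].
  exists (fun t => f' t * g' (f t)). split.
  - intros t Ht. exact (is_derive_comp g f t _ _ (Hg _ (HIJ t Ht)) (Hf t Ht)).
  - apply derivable_upto_mult; [exact Hf' |]. now apply IH.
Qed.

(** The derivative is a product of copies of [Rinv] up to sign, so the induction feeds on itself;
    [sqrt], with derivative [/ 2 * / sqrt x], is treated in the same way. *)
Lemma derivable_upto_inv (k : nat) : derivable_upto (Rlt 0) k Rinv.
Proof.
  induction k as [| k IH]; [easy |].
  exists (fun x => - (/ x * / x)). split.
  - intros x Hx. auto_derive; [lra | field; lra].
  - apply derivable_upto_opp. now apply derivable_upto_mult.
Qed.

Lemma derivable_upto_ln (k : nat) : derivable_upto (Rlt 0) k ln.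
Proof.
  destruct k as [| k]; [easy |].
  exists Rinv. split; [| apply derivable_upto_inv].
  intros x Hx. now apply is_derive_ln.
Qed.

Lemma derivable_upto_sqrt (k : nat) : derivable_upto (Rlt 0) k sqrt.
Proof.
  induction k as [| k IH]; [easy |].
  exists (fun x => / 2 * / sqrt x). split.
  - intros x Hx. pose proof (sqrt_lt_R0 x Hx).
    auto_derive; [lra | field; lra].
  - apply derivable_upto_mult; [apply derivable_upto_const |].
    apply (derivable_upto_comp (Rlt 0) (Rlt 0) k sqrt Rinv);
      [exact sqrt_lt_R0 | apply derivable_upto_inv | exact IH].
Qed.

(** * Transfer to [Derive] and [Derive_n] on an open set *)

Section LocalProperties.

Variable I : R -> Prop.
Hypothesis HI : forall t, I t -> locally t I.

Lemma locally_on (P : R -> Prop) (t : R) :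
  (forall s, I s -> P s) -> I t -> locally t P.
Proof. intros HP Ht. exact (filter_imp _ _ HP (HI t Ht)). Qed.

Lemma Derive_n_S_on (f f' : R -> R) (j : nat) :
  (forall t, I t -> is_derive f t (f' t)) ->
  forall t, I t -> Derive_n f (S j) t = Derive_n f' j t.
Proof.
  intros Hf. induction j as [| j IH]; intros t Ht.
  - exact (is_derive_unique _ _ _ (Hf t Ht)).
  - change (Derive (Derive_n f (S j)) t = Derive (Derive_n f' j) t).
    apply Derive_ext_loc. now apply locally_on.
Qed.

Lemma derivable_upto_ex_derive_n (k : nat) : forall f,
  derivable_upto I k f -> forall t, I t -> ex_derive_n f k t.
Proof.
  induction k as [| k IH]; intros f Hf t Ht; [easy |].
  destruct Hf as [f' [Hf Hf']]. destruct k as [| k].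
  - exists (f' t). now apply Hf.
  (* At order [k + 2] the claim is differentiability of [Derive_n f (S k)], which agrees with
     [Derive_n f' k] near [t] because [I] is open. *)
  - apply (ex_derive_ext_loc (Derive_n f' k)).
    + apply locally_on; [| exact Ht].
      intros s Hs. symmetry. now apply Derive_n_S_on.
    + exact (IH f' Hf' t Ht).
Qed.

Lemma smooth_on_ext (f g : R -> R) :
  (forall t, I t -> f t = g t) -> smooth_on I f -> smooth_on I g.
Proof.
  intros Hfg Hf k t Ht. apply (ex_derive_n_ext_loc f); [| now apply Hf].
  now apply locally_on.
Qed.

Lemma smooth_on_opp_ln (f : R -> R) :
  (forall t, I t -> 0 < f t) -> (forall k, derivable_upto I k f) ->
  smooth_on I (fun t => - ln (f t)).
Proof.
  intros Hpos Hf k. apply derivable_upto_ex_derive_n, derivable_upto_opp.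
  exact (derivable_upto_comp I (Rlt 0) k f ln Hpos (derivable_upto_ln k) (Hf k)).
Qed.

(** * Reduction of the system to equations for [f] *)

(** Substituting [rho' = - f1 / f] and [exp (2 * rho) = / f ^ 2] makes everything rational in [f],
    [f1], [f2]. Being an equivalence for arbitrary [f], it serves both to solve the system and to
    verify the solutions. *)
Lemma system_opp_ln_iff (n : Z) (a mu mubar : R) (Delta rho f f1 f2 : R -> R) :
  (2 < n)%Z ->
  (forall t, I t -> 0 < t) ->
  (forall t, I t -> 0 < a ^ 2 - mu * t) ->
  (forall t, I t -> Delta t = 1) ->
  (forall t, I t -> 0 < f t) ->
  (forall t, I t -> rho t = - ln (f t)) ->
  (forall t, I t -> is_derive f t (f1 t)) ->
  (forall t, I t -> is_derive f1 t (f2 t)) ->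
  forall t, I t ->
    (sysX n a mu mubar Delta rho t = 0 /\
     sysY n a mu mubar Delta rho t = 0 /\
     sysZ n a mu Delta rho t = 0) <->
    (2 * (a ^ 2 - mu * t) * f2 t = mu * f1 t /\
     mubar = mu * f t ^ 2 + 4 * (a ^ 2 - mu * t) * f t * f1 t
             - 4 * (a ^ 2 - mu * t) * t * f1 t ^ 2).
Proof.
  intros Hn Htpos HE HDelta Hf Hrho Hf1 Hf2.
  (* [Delta] is prescribed on [I] only; openness makes it locally constant there. *)
  assert (HD0 : forall t, I t -> is_derive Delta t 0).
  { intros t Ht. apply (is_derive_ext_loc (fun _ => 1)).
    - apply locally_on; [| exact Ht]. intros s Hs. symmetry. now apply HDelta.
    - apply (is_derive_const 1 t). }
  assert (HD2 : forall t, I t -> Derive_n Delta 2 t = 0).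
  { intros t Ht. rewrite (Derive_n_S_on Delta (fun _ => 0) 1 HD0 t Ht).
    apply (Derive_const 0 t). }
  assert (Hp : forall t, I t -> Derive rho t = - (f1 t / f t)).
  { intros t Ht. apply is_derive_unique.
    apply (is_derive_ext_loc (fun s => - ln (f s))).
    - apply locally_on; [| exact Ht]. intros s Hs. symmetry. now apply Hrho.
    - pose proof (Hf t Ht).
      auto_derive.
      + repeat split; try easy. now exists (f1 t); apply Hf1.
      + change (Derive (fun x => f x) t) with (Derive f t).
        rewrite (is_derive_unique _ _ _ (Hf1 t Ht)). field. lra. }
  assert (HU1 : forall t, I t -> Derive (U rho) t =
    - (2 * (f1 t / f t)) - 2 * t * (f2 t / f t - (f1 t / f t) ^ 2)).
  { intros t Ht. apply is_derive_unique.
    apply (is_derive_ext_loc (fun s => 1 + 2 * s * - (f1 s / f s))).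
    - apply locally_on; [| exact Ht].
      intros s Hs. unfold U. now rewrite Hp.
    - pose proof (Hf t Ht).
      auto_derive.
      + repeat split; try lra.
        * now exists (f2 t); apply Hf2.
        * now exists (f1 t); apply Hf1.
      + change (Derive (fun x => f x) t) with (Derive f t).
        change (Derive (fun x => f1 x) t) with (Derive f1 t).
        rewrite (is_derive_unique _ _ _ (Hf1 t Ht)).
        rewrite (is_derive_unique _ _ _ (Hf2 t Ht)). field. lra. }
  intros t Ht.
  assert (Hexp : exp (2 * rho t) = / f t ^ 2).
  { rewrite Hrho by exact Ht. pose proof (Hf t Ht) as Hft.
    replace (2 * - ln (f t)) with (- ln (f t) + - ln (f t)) by ring.
    rewrite exp_plus, exp_Ropp, exp_ln by exact Hft. field. lra. }
  assert (HN : 2 < IZR n) by now apply IZR_lt.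
  unfold sysX, sysY, sysZ; cbv zeta.
  rewrite Hexp, (HU1 t Ht), (HDelta t Ht), (HD2 t Ht).
  rewrite (is_derive_unique _ _ _ (HD0 t Ht)).
  unfold U. rewrite (Hp t Ht).
  generalize (Htpos t Ht) (HE t Ht) (Hf t Ht).
  generalize (f t) (f1 t) (f2 t) (IZR n) HN. clear.
  intros y y1 y2 N HN Ht HE Hy.
  set (E := a ^ 2 - mu * t) in *.
  (* Eliminating [a ^ 2] turns [E] into a free positive variable, a form in which [field] can check
     the identities. *)
  assert (Ha : a ^ 2 = E + mu * t) by (unfold E; ring).
  clearbody E. rewrite Ha.
  (* [A] and [B] are the residuals of the two target equations. The system is triangular in them:
     [Z] is a multiple of [A], and [X] combines [B] with [A]. Since [N > 2], the factors [N - 2] and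
     [N - 1] can be divided out. *)
  set (A := 2 * E * y2 - mu * y1).
  set (B := mu * y ^ 2 + 4 * E * y * y1 - 4 * E * t * y1 ^ 2 - mubar).
  match goal with |- (?X = 0 /\ ?Y = 0 /\ ?Z = 0) <-> _ =>
    assert (HX : X = ((N - 1) * B + 2 * t * A * y) / y ^ 2);
    [| assert (HY : Y = 0);
       [| assert (HZ : Z = 2 * (N - 2) * A / (E * y))]]
  end.
  { unfold A, B. field. lra. }
  { field. lra. }
  { unfold A. field. lra. }
  rewrite HX, HY, HZ. clear HX HY HZ.
  split.
  - intros [HX [_ HZ]].
    assert (HA : A = 0).
    { replace A with (2 * (N - 2) * A / (E * y) * (E * y) / (2 * (N - 2)))
        by (field; lra).
      rewrite HZ. field. lra. }
    assert (HB : B = 0).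
    { replace B with ((((N - 1) * B + 2 * t * A * y) / y ^ 2 * y ^ 2
                       - 2 * t * A * y) / (N - 1)) by (field; lra).
      rewrite HX, HA. field. lra. }
    unfold A in HA. unfold B in HB. split; lra.
  - intros [H1 H2].
    assert (HA : A = 0) by (unfold A; lra).
    assert (HB : B = 0) by (unfold B; lra).
    rewrite HA, HB. repeat split; field; lra.
Qed.

End LocalProperties.

(** * Explicit solutions in the two cases *)

Theorem lemma5p3 (n : Z) (a mu : R) (l r : Rbar) (Delta : R -> R)
    (hn : (2 < n)%Z) (ha : a <> 0)
    (hl : Rbar_le 0 l) (hlr : Rbar_lt l r)
    (hpos : forall t : R, in_open_itv l r t -> 0 < a ^ 2 - mu * t)
    (hDelta : forall t : R, in_open_itv l r t -> Delta t = 1)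
    (rho : R -> R) (mubar : R) :
  (mu = 0 ->
     (is_solution (in_open_itv l r) n a mu Delta rho mubar <->
      exists C D : R,
        (forall t : R, in_open_itv l r t ->
           0 < C + D * t /\ rho t = - ln (C + D * t)) /\
        mubar = 4 * C * D * a ^ 2)) /\
  (mu <> 0 ->
     (is_solution (in_open_itv l r) n a mu Delta rho mubar <->
      exists C D : R,
        (forall t : R, in_open_itv l r t ->
           0 < C + D * sqrt (a ^ 2 - mu * t) /\
           rho t = - ln (C + D * sqrt (a ^ 2 - mu * t))) /\
        mubar = (C ^ 2 - D ^ 2 * a ^ 2) * mu)).
Proof.
  set (I := in_open_itv l r) in *.
  assert (HI : forall t, I t -> locally t I) by apply in_open_itv_locally.
  assert (Htpos : forall t, I t -> 0 < t).
  { intros t. now apply in_open_itv_pos. }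
  (* Base point at which the integration constants and [mubar] are read off. *)
  destruct (in_open_itv_inhabited l r hlr) as [t0 Ht0]. fold I in Ht0.
  assert (Hiff : forall f f1 f2, _) by
    exact (fun f f1 f2 => system_opp_ln_iff I HI n a mu mubar Delta rho f f1 f2
             hn Htpos hpos hDelta).
  assert (Hfwd : is_solution I n a mu Delta rho mubar ->
    exists f f1 f2 : R -> R,
      (forall t, I t -> 0 < f t) /\
      (forall t, I t -> rho t = - ln (f t)) /\
      (forall t, I t -> is_derive f t (f1 t)) /\
      (forall t, I t -> is_derive f1 t (f2 t)) /\
      (forall t, I t ->
        2 * (a ^ 2 - mu * t) * f2 t = mu * f1 t /\
        mubar = mu * f t ^ 2 + 4 * (a ^ 2 - mu * t) * f t * f1 t
                - 4 * (a ^ 2 - mu * t) * t * f1 t ^ 2)).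
  { intros [Hs Hsys].
    set (f := fun t => exp (- rho t)).
    set (f1 := fun t => - Derive rho t * f t).
    set (f2 := fun t => (Derive rho t ^ 2 - Derive (Derive rho) t) * f t).
    assert (Hf : forall t, I t -> 0 < f t) by (intros; apply exp_pos).
    assert (Hrho : forall t, I t -> rho t = - ln (f t)).
    { intros t _. unfold f. rewrite ln_exp. ring. }
    assert (Hf1 : forall t, I t -> is_derive f t (f1 t)).
    { intros t Ht. unfold f1, f. auto_derive.
      - exact (Hs 1%nat t Ht).
      - change (Derive (fun x => rho x) t) with (Derive rho t). ring. }
    assert (Hf2 : forall t, I t -> is_derive f1 t (f2 t)).
    { intros t Ht. unfold f2, f1, f. auto_derive.
      - split; [exact (Hs 2%nat t Ht) |]. split; [exact (Hs 1%nat t Ht) | easy].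
      - change (Derive (fun x => rho x) t) with (Derive rho t).
        change (Derive (fun x => Derive rho x) t) with (Derive (Derive rho) t).
        ring. }
    exists f, f1, f2. repeat (split; [assumption |]).
    intros t Ht. now apply (Hiff f f1 f2 Hf Hrho Hf1 Hf2 t Ht), Hsys. }
  set (s := fun t => sqrt (a ^ 2 - mu * t)).
  assert (Hspos : forall t, I t -> 0 < s t).
  { intros t Ht. now apply sqrt_lt_R0, hpos. }
  assert (Hs2 : forall t, I t -> a ^ 2 - mu * t = s t ^ 2).
  { intros t Ht. unfold s. rewrite pow2_sqrt; [easy |].
    now apply Rlt_le, hpos. }
  assert (Hs : forall t, I t -> is_derive s t (- mu / (2 * s t))).
  { intros t Ht. pose proof (Hspos t Ht). unfold s in *.
    pose proof (hpos t Ht). auto_derive; [simpl in *; lra |].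
    simpl in *. unfold Rminus in *. field. lra. }
  split; intros Hmu; split.
  - intros Hsol. destruct (Hfwd Hsol) as (f & f1 & f2 & Hf & Hrho & Hf1 & Hf2 & Heq).
    assert (Hconst1 : forall t, I t -> f1 t = f1 t0).
    { intros t Ht. apply (is_derive_0_const_on l r); [| exact Ht | exact Ht0].
      intros v Hv. replace 0 with (f2 v); [now apply Hf2 |].
      destruct (Heq v Hv) as [H _]. pose proof (hpos v Hv) as HE.
      rewrite Hmu in H, HE.
      (* For [mu = 0] the linear equation is [2 * a ^ 2 * f2 = 0], and [HE] permits the
         cancellation. *)
      apply (Rmult_eq_reg_l (2 * (a ^ 2 - 0 * v))); [rewrite H; ring | lra]. }
    set (D := f1 t0) in *. set (C := f t0 - D * t0).
    assert (Haff : forall t, I t -> f t = C + D * t).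
    { intros t Ht.
      enough (f t - D * t = C) by lra. unfold C.
      apply (is_derive_0_const_on l r (fun t => f t - D * t));
        [| exact Ht | exact Ht0].
      intros v Hv. replace 0 with (f1 v - D) by (rewrite (Hconst1 v Hv); ring).
      apply (is_derive_minus f (fun t => D * t)); [now apply Hf1 |].
      auto_derive; [easy | ring]. }
    exists C, D. split.
    + intros t Ht. rewrite <- (Haff t Ht). auto.
    + destruct (Heq t0 Ht0) as [_ ->].
      rewrite (Haff t0 Ht0). fold D. rewrite Hmu. ring.
  - intros (C & D & HCD & Hmubar).
    set (f := fun t => C + D * t).
    assert (Hf : forall t, I t -> 0 < f t) by (intros; now apply HCD).
    assert (Hrho : forall t, I t -> rho t = - ln (f t)) by (intros; now apply HCD).
    split.
    + apply (smooth_on_ext I HI (fun t => - ln (f t))).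
      { intros t Ht. symmetry. now apply Hrho. }
      apply (smooth_on_opp_ln I HI f Hf). intros k.
      apply derivable_upto_plus; [apply derivable_upto_const |].
      apply derivable_upto_mult;
        [apply derivable_upto_const | apply derivable_upto_id].
    + intros t Ht. apply (Hiff f (fun _ => D) (fun _ => 0) Hf Hrho).
      * intros v _. unfold f. auto_derive; [easy | ring].
      * intros v _. auto_derive; easy.
      * exact Ht.
      * unfold f. rewrite Hmu, Hmubar. split; ring.
  - intros Hsol. destruct (Hfwd Hsol) as (f & f1 & f2 & Hf & Hrho & Hf1 & Hf2 & Heq).
    (* First integral: the derivative of [f1 * s] is [(2 * s ^ 2 * f2 - mu * f1) / (2 * s)], which
       vanishes by the linear equation since [s ^ 2 = a ^ 2 - mu * t]. *)
    set (K := f1 t0 * s t0).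
    assert (HK : forall t, I t -> f1 t * s t = K).
    { intros t Ht.
      apply (is_derive_0_const_on l r (fun t => f1 t * s t));
        [| exact Ht | exact Ht0].
      intros v Hv. pose proof (Hspos v Hv).
      destruct (Heq v Hv) as [H0 _]. rewrite (Hs2 v Hv) in H0.
      replace 0 with (f2 v * s v + f1 v * (- mu / (2 * s v))).
      - exact (is_derive_mult f1 s v _ _ (Hf2 v Hv) (Hs v Hv) Rmult_comm).
      - replace (f2 v * s v + f1 v * (- mu / (2 * s v)))
          with ((2 * s v ^ 2 * f2 v - mu * f1 v) / (2 * s v)) by (field; lra).
        rewrite H0. field. lra. }
    (* [D] is forced by [f1 = D * s'] with [s' = - mu / (2 * s)], which gives [K = - mu * D / 2]. *)
    set (D := - (2 * K / mu)). set (C := f t0 - D * s t0).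
    assert (Haff : forall t, I t -> f t = C + D * s t).
    { intros t Ht.
      enough (f t - D * s t = C) by lra. unfold C.
      apply (is_derive_0_const_on l r (fun t => f t - D * s t));
        [| exact Ht | exact Ht0].
      intros v Hv. pose proof (Hspos v Hv).
      replace 0 with (f1 v - D * (- mu / (2 * s v))).
      - apply (is_derive_minus f (fun t => D * s t)); [now apply Hf1 |].
        exact (is_derive_scal s v D _ (Hs v Hv)).
      - unfold D. rewrite <- (HK v Hv). field. lra. }
    exists C, D. split.
    + intros t Ht. fold (s t). rewrite <- (Haff t Ht). auto.
    + destruct (Heq t0 Ht0) as [_ ->].
      pose proof (Hspos t0 Ht0).
      assert (H1 : f1 t0 = - mu * D / (2 * s t0)).
      { unfold D, K. field. lra. }
      rewrite (Haff t0 Ht0), H1.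
      (* The formula for [mubar] collapses to [mu * (C ^ 2 - D ^ 2 * (s t0 ^ 2 + mu * t0))], so the
         base point disappears. *)
      assert (Ha2 : a ^ 2 = s t0 ^ 2 + mu * t0) by (rewrite <- Hs2; auto; ring).
      rewrite Ha2. field. lra.
  - intros (C & D & HCD & Hmubar).
    set (f := fun t => C + D * s t).
    assert (Hf : forall t, I t -> 0 < f t) by (intros; now apply HCD).
    assert (Hrho : forall t, I t -> rho t = - ln (f t)) by (intros; now apply HCD).
    split.
    + apply (smooth_on_ext I HI (fun t => - ln (f t))).
      { intros t Ht. symmetry. now apply Hrho. }
      apply (smooth_on_opp_ln I HI f Hf). intros k.
      apply derivable_upto_plus; [apply derivable_upto_const |].
      apply derivable_upto_mult; [apply derivable_upto_const |].
      apply (derivable_upto_comp I (Rlt 0) k (fun t => a ^ 2 - mu * t) sqrt).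
      * exact hpos.
      * apply derivable_upto_sqrt.
      * apply derivable_upto_plus; [apply derivable_upto_const |].
        apply derivable_upto_opp, derivable_upto_mult;
          [apply derivable_upto_const | apply derivable_upto_id].
    + intros t Ht.
      (* The witnesses are the first two derivatives of [C + D * s], obtained from
         [s' = - mu / (2 * s)]. *)
      apply (Hiff f (fun t => D * (- mu / (2 * s t)))
               (fun t => - (D * mu ^ 2 / (4 * s t ^ 3))) Hf Hrho).
      * intros v Hv. unfold f.
        replace (D * (- mu / (2 * s v))) with (0 + D * (- mu / (2 * s v))) by ring.
        apply (is_derive_plus (fun _ => C) (fun t => D * s t));
          [apply (is_derive_const C v) | exact (is_derive_scal s v D _ (Hs v Hv))].
      * intros v Hv. pose proof (Hspos v Hv). auto_derive.
        -- repeat split; [| lra]. eexists. exact (Hs v Hv).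
        -- change (Derive (fun x => s x) v) with (Derive s v).
           rewrite (is_derive_unique _ _ _ (Hs v Hv)). field. lra.
      * exact Ht.
      * pose proof (Hspos t Ht).
        assert (Ha2 : a ^ 2 = s t ^ 2 + mu * t) by (rewrite <- Hs2; auto; ring).
        unfold f. rewrite Hmubar, Ha2. split; field; lra.
Qed.
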